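(* Let $M$ be a compact metric space with at least two points. For every homeomorphism $h : M \to M$ of $M$ onto $M$, the induced map $\widetilde{h} : \mathcal{M}(M) \to \mathcal{M}(M)$ has no point of chain continuity, i.e. there is no $\mu \in \mathcal{M}(M)$ at which $\widetilde{h}$ is chain continuous.
   Context: For a compact metric space $(M,d)$, $\mathcal{M}(M)$ is the space of Borel probability measures on $M$ with the Prohorov metric $d_P(\mu,\nu)=\inf\{\delta>0:\mu(X)\le\nu(X^\delta)+\delta \text{ and } \nu(X)\le\mu(X^\delta)+\delta \text{ for all Borel } X\subset M\}$, where $X^\delta=\{x\in M: d(x,X)<\delta\}$; it is a compact metric space. For a continuous map $f:M\to M$, the induced map $\widetilde f:\mathcal{M}(M)\to\mathcal{M}(M)$ is $(\widetilde f(\mu))(X)=\mu(f^{-1}(X))$ for Borel $X$. A self-map $g$ of a metric space with metric $\rho$ (open balls denoted $B(\cdot\,;\delta)$) is chain continuous at a point $x$ if for every $\varepsilon>0$ there exists $\delta>0$ such that for any choice of points $x_0\in B(x;\delta)$, $x_1\in B(g(x_0);\delta)$, $x_2\in B(g(x_1);\delta),\dots$, we have $\rho(x_n,g^n(x))<\varepsilon$ for all $n\ge 0$. *)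

(* Defs.v *)
From HB Require Import structures.
From mathcomp Require Import all_boot all_order all_algebra.
From mathcomp Require Import all_classical all_reals all_analysis.
Set Implicit Arguments.
Unset Strict Implicit.
Unset Printing Implicit Defensive.
Import Order.TTheory GRing.Theory Num.Theory.

Local Open Scope classical_set_scope.
Local Open Scope ring_scope.

(* [measurableType] inherits from [pointedType]; hence a metric space carrying
   measures comes with a distinguished point, i.e. it is merely nonempty. *)
#[short(type="pmetricType")]
HB.structure Definition PointedMetric (K : numDomainType) :=
  { M of Metric K M & Pointed M }.

Notation borel M := (g_sigma_algebraType (@open M)).

(* A measure is a function on all of [set M], but only its values on Borel sets
   are meaningful: elements of [borel_probability M] agreeing on Borel sets are
   the same measure, and they are at [prohorov] distance 0. *)
Notation borel_probability R M := (probability (borel M) R).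

Section defs.
Context {R : realType}.

(* Extended-real valued, so that the distance to the empty set is +oo. *)
Definition dist_set (M : metricType R) (x : M) (X : set M) : \bar R :=
  ereal_inf [set (mdist x y)%:E | y in X].

Definition thickening (M : metricType R) (X : set M) (delta : R) : set M :=
  [set x | (dist_set x X < delta%:E)%E].

(* The set below contains 1 and is bounded below by 0, so that [inf] is the
   infimum. *)
Definition prohorov (M : pmetricType R) (mu nu : borel_probability R M) : R :=
  inf [set delta : R | 0 < delta /\
    forall X : set (borel M), measurable X ->
      (mu X <= nu (thickening X delta) + delta%:E)%E /\
      (nu X <= mu (thickening X delta) + delta%:E)%E].

Definition chain_continuous (T : Type) (rho : T -> T -> R) (g : T -> T)
    (x : T) : Prop :=
  forall eps : R, 0 < eps -> exists2 delta : R, 0 < delta &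
    forall u : nat -> T,
      rho x (u 0%N) < delta ->
      (forall n, rho (g (u n)) (u n.+1) < delta) ->
      forall n, rho (u n) (iter n g x) < eps.

End defs.

Definition homeomorphism (S T : topologicalType) (h : S -> T) : Prop :=
  continuous h /\
  exists k : T -> S, [/\ continuous k, cancel h k & cancel k h].

Lemma homeomorphism_continuous (S T : topologicalType) (h : S -> T) :
  homeomorphism h -> continuous h.
Proof. by case. Qed.

Section induced_map.
Context {R : realType} (M : pmetricType R) (f : M -> M).
Hypothesis cf : continuous f.

Lemma continuous_borel_measurable :
  measurable_fun [set: borel M] (f : borel M -> borel M).
Proof.
apply: (@measurability _ _ (borel M) (borel M) setT f (@open M)) => //.
move=> _ [B oB <-]; rewrite setTI; apply: sub_sigma_algebra.
by move/continuousP : cf; exact.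
Qed.

Definition borel_mfun : {mfun borel M >-> borel M} :=
  mfun_Sub (mem_set continuous_borel_measurable).

(* [distribution mu g] is the measure [X |-> mu (g @^-1` X)]. *)
Definition induced_map (mu : borel_probability R M) : borel_probability R M :=
  distribution mu borel_mfun.

Lemma induced_mapE (mu : borel_probability R M) (X : set (borel M)) :
  induced_map mu X = mu (f @^-1` X).
Proof. by []. Qed.

End induced_map.

(* Main.v *)
Require Import Defs.
From HB Require Import structures.
From mathcomp Require Import all_boot all_order all_algebra.
From mathcomp Require Import all_classical all_reals all_analysis.
From mathcomp Require Import lra.
(* For any probability nu, the convex combinations
   u_n = (1 - s_n) h~^n mu + s_n h~^n nu with s_n increasing from 0 to 1 by steps
   less than delta form a delta-chain of h~, since h~ is affine and the Prohorov
   distance is dominated by the total variation. Chain continuity at mu thus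
   gives an N, independent of nu, such that h~^N nu is close to h~^N mu. As h is
   onto, h~^N nu can be any Dirac mass, so that h~^N mu is concentrated near
   every point of M, which is absurd if M has two points. *)

Set Implicit Arguments.
Unset Strict Implicit.
Unset Printing Implicit Defensive.
Import Order.TTheory GRing.Theory Num.Theory.

Local Open Scope classical_set_scope.
Local Open Scope ring_scope.

Section prob_mix.
Context d (T : measurableType d) (R : realType).
Variables (p : {i01 R}) (P Q : probability T R).

(** The weight ranges over [{i01 R}] so that both coefficients are nonnegative, as [mscale]
    requires. *)
Definition prob_mix : set T -> \bar R :=
  measure_add (mscale (1 - p%:num)%:nng P) (mscale p%:num%:nng Q).

HB.instance Definition _ := Measure.on prob_mix.

Lemma prob_mixE A : prob_mix A = ((1 - p%:num)%:E * P A + p%:num%:E * Q A)%E.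
Proof. by rewrite /prob_mix measure_addE. Qed.

Let prob_mix_setT : prob_mix setT = 1%E.
Proof. by rewrite prob_mixE !probability_setT !mule1 -EFinD subrK. Qed.

HB.instance Definition _ :=
  Measure_isProbability.Build _ _ _ prob_mix prob_mix_setT.

End prob_mix.

(** The two mixtures differ on [A] by [(p - q) * (Q A - P A)], and [P A] and [Q A] both lie in
    [0, 1]. *)
Lemma prob_mix_le d (T : measurableType d) (R : realType) (p q : {i01 R})
    (P Q : probability T R) (e : R) (A : set T) : measurable A ->
  `|p%:num - q%:num| <= e -> (prob_mix p P Q A <= prob_mix q P Q A + e%:E)%E.
Proof.
move=> mA; rewrite ler_norml => /andP[pq1 pq2]; rewrite !prob_mixE.
have arith (s t : R) (a b : \bar R) : - e <= s - t -> s - t <= e ->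
    (0 <= a <= 1 -> 0 <= b <= 1 ->
     (1 - s)%:E * a + s%:E * b <= (1 - t)%:E * a + t%:E * b + e%:E)%E.
  move=> st1 st2; case: a => [a| |]; last 2 first.
  - by rewrite leye_eq andbF.
  - by rewrite leeNy_eq.
  case: b => [b| |] => [|_|_]; last 2 first.
  - by rewrite leye_eq andbF.
  - by rewrite leeNy_eq.
  rewrite -!EFinM -!EFinD !lee_fin => /andP[a0 a1] /andP[b0 b1]; nra.
by apply: arith => //; rewrite measure_ge0 probability_le1.
Qed.

Section prohorov.
Context {R : realType}.

Lemma open_thickening (M : metricType R) (X : set M) (e : R) :
  open (thickening X e).
Proof.
rewrite openE => x /ereal_inf_lt[_ [y Xy <-]]; rewrite lte_fin => xy.
apply/nbhs_ballP; exists (e - mdist x y); rewrite /= ?subr_gt0// => z.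
rewrite ballEmdist /= => xz.
apply: le_lt_trans (_ : (mdist z y)%:E < _)%E.
  by apply: ereal_inf_lbound; exists y.
have := metric_triangle z x y; rewrite (metric_sym z x) lte_fin; lra.
Qed.

Lemma measurable_thickening (M : pmetricType R) (X : set M) (e : R) :
  measurable (thickening X e : set (borel M)).
Proof. by apply: sub_sigma_algebra; exact: open_thickening. Qed.

Lemma le_thickening (M : metricType R) (X : set M) (e f : R) : e <= f ->
  thickening X e `<=` thickening X f.
Proof. by move=> ef x /lt_le_trans; apply; rewrite lee_fin. Qed.

Lemma sub_thickening (M : metricType R) (X : set M) (e : R) : 0 < e ->
  X `<=` thickening X e.
Proof.
move=> e0 x Xx; apply: le_lt_trans (_ : (mdist x x)%:E < _)%E.
  by apply: ereal_inf_lbound; exists x.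
by rewrite mdistxx lte_fin.
Qed.

(** Since [X] is contained in its thickening, a bound uniform over Borel sets makes [e] admissible
    in the infimum. *)
Lemma prohorov_le (M : pmetricType R) (mu nu : borel_probability R M) (e : R) :
    0 < e ->
    (forall X : set (borel M), measurable X ->
      (mu X <= nu X + e%:E)%E /\ (nu X <= mu X + e%:E)%E) ->
  prohorov mu nu <= e.
Proof.
move=> e0 munu; apply: ge_inf; first by exists 0 => x [/ltW].
split=> // X mX; have [h1 h2] := munu X mX.
have mt := @measurable_thickening M X e.
by split; [apply: le_trans h1 _|apply: le_trans h2 _]; rewrite leeD2r//;
  apply: le_measure; rewrite ?inE//; exact: sub_thickening.
Qed.

Lemma prohorov_lt (M : pmetricType R) (mu nu : borel_probability R M) (e : R)
    (X : set (borel M)) : measurable X ->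
  prohorov mu nu < e -> (mu X <= nu (thickening X e) + e%:E)%E.
Proof.
move=> mX /inf_lt[].
  (* The infimum is over a nonempty set: 1 is admissible because probabilities are at most 1. *)
  exists 1; split=> // Y mY.
  by split; apply: le_trans (probability_le1 _ mY) _; rewrite leeDr.
move=> f [f0 /(_ X mX)[+ _]] fe => /le_trans; apply.
rewrite leeD ?lee_fin ?(ltW fe)//.
by apply: le_measure; rewrite ?inE; [exact: measurable_thickening..|];
  apply: le_thickening; exact: ltW.
Qed.

End prohorov.

Section induced_map_theory.
Context {R : realType} (M : pmetricType R) (h : M -> M) (ch : continuous h).
Local Notation g := (induced_map ch : borel_probability R M -> _).

Lemma iter_induced_mapE (mu : borel_probability R M) n (X : set (borel M)) :
  iter n g mu X = mu (iter n h @^-1` X).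
Proof.
elim: n X => // n IH X; rewrite iterS induced_mapE IH.
by congr (mu _); apply/seteqP; split => x /=; rewrite -iterS.
Qed.

Lemma chain_continuous_iter (mu : borel_probability R M) (e : R) :
    0 < e -> chain_continuous (@prohorov R M) g mu ->
  exists N, forall (nu : borel_probability R M) (X : set (borel M)),
    measurable X ->
    (iter N g nu X <= iter N g mu (thickening X e) + e%:E)%E.
Proof.
move=> e0 /(_ _ e0)[dl dl0 cc].
(* Half of [dl], because [prohorov_le] yields only a large inequality while the chain needs a strict
   one. *)
pose t := dl / 2; have t0 : 0 < t by rewrite divr_gt0.
(* The weights grow by steps of [t] and are truncated at 1, since the chain must be infinite. *)
have s0 n : 0 <= Num.min 1 (n%:R * t).
  by rewrite le_min ler01 mulr_ge0// ltW.
have s1 n : Num.min 1 (n%:R * t) <= 1 by rewrite ge_min lexx.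
pose s n := Itv01 (s0 n) (s1 n).
have sE n : (s n)%:num = Num.min 1 (n%:R * t) by [].
(* By the Archimedean property [N * t] is at least 1; [N] depends on [dl] only, not on [nu]. *)
pose N := Num.bound t^-1.
have sN : (s N)%:num = 1.
  rewrite sE; apply/min_idPl; rewrite -ler_pdivrMr// div1r.
  by apply/ltW/archi_boundP; rewrite invr_ge0 ltW.
exists N => nu X mX.
pose u n : borel_probability R M := prob_mix (s n) (iter n g mu) (iter n g nu).
have uE n A : u n A =
    ((1 - (s n)%:num)%:E * iter n g mu A + (s n)%:num%:E * iter n g nu A)%E.
  exact: prob_mixE.
have t_dl : t < dl by rewrite ltr_pdivrMr// ltr_pMr// ltr1n.
have /(_ N) uN : forall n, prohorov (u n) (iter n g mu) < e.
  apply: cc => [|n]; apply: le_lt_trans t_dl; apply: prohorov_le => // Y mY.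
    have -> : u 0%N Y = mu Y.
      by rewrite uE sE mul0r min_r// subr0 mul1e mul0e adde0.
    by split; rewrite leeDl// lee_fin ltW.
  (* As [g] is affine, [g (u n)] and [u n.+1] mix the same two measures and differ only in the
     weight. *)
  have -> : g (u n) Y = prob_mix (s n) (iter n.+1 g mu) (iter n.+1 g nu) Y.
    by rewrite induced_mapE uE prob_mixE.
  have ss : `|(s n)%:num - (s n.+1)%:num| <= t.
    rewrite !sE -natr1 mulrDl mul1r ler_norml /Num.min.
    by case: ifPn => ?; case: ifPn => ?; apply/andP; split; lra.
  by split; apply: prob_mix_le => //; rewrite distrC.
have -> : iter N g nu X = u N X.
  by rewrite uE sN subrr mul1e mul0e add0e.
exact: prohorov_lt.
Qed.

End induced_map_theory.

Theorem theorem12 (R : realType) (M : pmetricType R)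
    (compactM : compact [set: M]) (two_points : exists x y : M, x <> y)
    (h : M -> M) (homeo_h : homeomorphism h) :
  ~ exists mu : borel_probability R M,
      chain_continuous (@prohorov R M)
        (induced_map (homeomorphism_continuous homeo_h)) mu.
Proof.
move=> [mu cc]; have [x [y /eqP xy]] := two_points.
have [_ [k [_ _ kh]]] := homeo_h.
(* The first bound makes the [e]-thickenings of [x] and [y] disjoint; the second gives
   [2 * (1 - e) > 1]. *)
pose e : R := Num.min (mdist x y / 2) 3^-1.
have e0 : 0 < e by rewrite lt_min invr_gt0 ltr0n divr_gt0// mdist_gt0.
have [N muN] := chain_continuous_iter e0 cc.
set la := iter N _ mu in muN.
have near z : (1 <= la (thickening [set z] e) + e%:E)%E.
  have m1 : measurable ([set z] : set (borel M)).
    rewrite -(setCK [set z]); apply: measurableC; apply: sub_sigma_algebra.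
    rewrite openC; apply: accessible_closed_set1.
    exact/hausdorff_accessible/metric_hausdorff.
  (* The induced map iterated [N] times sends the Dirac mass at [iter N k z] to the Dirac mass at
     [z]. *)
  have := muN (\d_(iter N k z : borel M)) _ m1.
  rewrite iter_induced_mapE /= diracE mem_set//=.
  have kNK : cancel (iter N k) (iter N h).
    by elim: (N) => // n IH w; rewrite iterSr iterS kh.
  by rewrite kNK.
have disj : thickening [set x] e `&` thickening [set y] e = set0.
  rewrite -subset0 => z [].
  rewrite /thickening /dist_set /= !image_set1 !ereal_inf1 !lte_fin => xz yz.
  have := metric_triangle x z y; rewrite metric_sym (metric_sym x z).
  have : e <= mdist x y / 2 by rewrite ge_min lexx.
  by rewrite (metric_sym y x); lra.
have mt z := @measurable_thickening R M [set z] e.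
have arith (a b : \bar R) :
    (a + b <= 1 -> 1 <= a + e%:E -> 1 <= b + e%:E -> False)%E.
  have : e <= 3^-1 by rewrite ge_min lexx orbT.
  by case: a b => [a| |] [b| |]//=; rewrite -!EFinD !lee_fin; lra.
(* Two disjoint sets would each have [la]-mass at least [1 - e], hence total mass above 1. *)
apply: arith (near x) (near y).
have := probability_le1 la (measurableU _ _ (mt x) (mt y)).
by rewrite measureU.
Qed.
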